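(* Let $C$ be a complete set of diameter $1$ in a strictly convex Minkowski space $(\mathbb{R}^n,\|\cdot\|)$. Then $K_0=\operatorname{cl}(\operatorname{conv}(\operatorname{b-exp}(C)))$ is the unique minimal (under inclusion) convex body whose unique completion is $C$.
   Context: A Minkowski space $(\mathbb{R}^n,\|\cdot\|)$ is $\mathbb{R}^n$, $n\ge 1$, equipped with an arbitrary norm; it is strictly convex if the boundary of the unit ball contains no segment $[x_1,x_2]$ with $x_1\neq x_2$. For $x\in\mathbb{R}^n$ and $r\ge 0$, $B(x,r)=\{y:\|y-x\|\le r\}$ is the closed ball and $S(x,r)=\{y:\|y-x\|=r\}$ the sphere; $\operatorname{cl}$ and $\operatorname{conv}$ denote closure and convex hull, and $\operatorname{diam}$ is the diameter with respect to $\|\cdot\|$. A convex body is a compact, convex, non-empty subset of $\mathbb{R}^n$ (it may have empty interior). A bounded non-empty set $C\subseteq\mathbb{R}^n$ is complete if $\operatorname{diam}(C\cup\{x\})>\operatorname{diam}(C)$ for every $x\in\mathbb{R}^n\setminus C$. A complete set $C$ is a completion of a bounded non-empty set $S$ if $S\subseteq C$ and $\operatorname{diam}(C)=\operatorname{diam}(S)$. A set $S$ is b-convex if it equals its ball hull $\operatorname{bh}_1(S)=\bigcap_{x\in\mathbb{R}^n:\,S\subseteq B(x,1)}B(x,1)$ (the intersection of an empty family is $\mathbb{R}^n$); a b-convex body is a bounded non-empty b-convex set. (A complete set of diameter $1$ is a b-convex body.) A supporting sphere of a b-convex body $C$ is a sphere $S(x,1)$ of radius $1$ with $C\subseteq B(x,1)$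 and $C\cap S(x,1)\neq\emptyset$; the set $C\cap S(x,1)$ is then called an exposed b-face of $C$. If an exposed b-face is a singleton $\{x_0\}$, then $x_0$ is a b-exposed point of $C$; $\operatorname{b-exp}(C)$ is the set of all b-exposed points of $C$. *)

(* Defs.v *)
From HB Require Import structures.
From mathcomp Require Import all_boot all_order all_algebra.
From mathcomp Require Import all_classical all_reals all_analysis.

Set Implicit Arguments.
Unset Strict Implicit.
Unset Printing Implicit Defensive.

Import Order.TTheory GRing.Theory Num.Theory.
Import numFieldNormedType.Exports.

Local Open Scope classical_set_scope.
Local Open Scope ring_scope.

(* A Minkowski space is 'rV[R]_n together with a function N satisfying is_norm.
   Metric notions (balls, boundedness, diameter, completeness) refer to N.
   Topological ones (closure, interior, compact) refer to the product topology
   of 'rV[R]_n, which is the topology of every norm on R^n. *)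

Record is_norm (R : realType) (n : nat) (N : 'rV[R]_n -> R) : Prop := IsNorm {
  is_norm_triangle : forall x y, N (x + y) <= N x + N y ;
  is_norm_scale : forall (a : R) x, N (a *: x) = `|a| * N x ;
  is_norm_eq0 : forall x, N x = 0 -> x = 0 }.

Section Minkowski.
Context {R : realType} {n : nat}.
Local Notation V := 'rV[R]_n.
Variable N : V -> R.
Implicit Types (x y : V) (C D F K S : set V).

Definition sphere x (r : R) : set V := [set y | N (x - y) = r].

Definition segment x y : set V :=
  [set (1 - t) *: x + t *: y | t in `[0, 1]%classic].

Definition strictly_convex : Prop :=
  ~ exists x y, x <> y /\
      segment x y `<=` closure (closed_ball_ N 0 1) `\` interior (closed_ball_ N 0 1).

Definition norm_bounded S : Prop := exists r : R, forall x, S x -> N x <= r.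

(* The supremum is the diameter only when S is bounded and non-empty. *)
Definition diam S : R := sup [set N (x - y) | x in S & y in S].

Definition complete_set C : Prop :=
  [/\ norm_bounded C, C !=set0 &
      forall x, ~ C x -> diam C < diam (C `|` [set x])].

(* completion S C: C is a completion of S *)
Definition completion S C : Prop :=
  [/\ norm_bounded S, S !=set0, complete_set C, S `<=` C & diam C = diam S].

Definition supporting_sphere C x : Prop :=
  C `<=` closed_ball_ N x 1 /\ C `&` sphere x 1 !=set0.

Definition exposed_bface C F : Prop :=
  exists x, supporting_sphere C x /\ F = C `&` sphere x 1.

Definition b_exp C : set V := [set x0 | exposed_bface C [set x0]].

Definition conv_hull S : set V := smallest (@convex_set R V) S.

Definition convex_body K : Prop :=
  [/\ compact K, @convex_set R V K & K !=set0].

Definition minimal (P : set V -> Prop) K : Prop :=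
  P K /\ forall L, P L -> L `<=` K -> L = K.

End Minkowski.

(* Main.v *)
Require Import Defs.
From HB Require Import structures.
From mathcomp Require Import all_boot all_order all_algebra.
From mathcomp Require Import all_classical all_reals all_analysis.
From mathcomp Require Import ring lra.

Set Implicit Arguments.
Unset Strict Implicit.
Unset Printing Implicit Defensive.

Import Order.TTheory GRing.Theory Num.Theory.
Import numFieldNormedType.Exports.

Local Open Scope classical_set_scope.
Local Open Scope ring_scope.

(** A complete set C of diameter 1 consists of the points at distance at most 1
    from every point of C; in particular it is convex and compact, and it
    contains the centre of each of its supporting spheres.

    The heart of the matter is unit_ball_hull_b_exp: a unit ball that contains
    the b-exposed points of C contains C. This is an analogue of Straszewicz's
    theorem. A boundary point x of C is one whose largest distance to C is 1. If
    only one point of C realises that distance, it is b-exposed. So it is enough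
    that such x are dense in the boundary. They are: choose w inside C near a
    given boundary point and let x be the boundary point nearest to w in the
    Euclidean norm. The Euclidean ball around w through x lies in the unit ball
    around each point y of C farthest from x, and x is on both surfaces. Hence
    all these unit balls have the tangent hyperplane of the Euclidean ball at x
    as their only supporting hyperplane there, and strict convexity leaves only
    one possible y (touching_center_unique).

    Put K0 for the closed convex hull of the b-exposed points. It has diameter 1
    (diam_b_exp_sub), and if D is complete of diameter 1 and contains K0, then
    every unit ball around a point of D contains the b-exposed points, so
    D is contained in C, whence D = C. So C is the only completion of K0.

    Conversely, every convex body K whose only completion is C contains each
    b-exposed point y (b_exp_sub_unique_completion): otherwise the centre of a
    sphere exposing y could be moved away from y and still be added to K without
    enlarging the diameter, giving a completion other than C. Thus K0 is the
    least such body, and a fortiori the unique minimal one. *)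

(** * Norms on row vectors *)

Ltac row_field := apply/rowP => ?; rewrite !mxE; field.

Section NormOnRows.
Context {R : realType} {n : nat} {N : 'rV[R]_n -> R} (N_norm : is_norm N).
Local Notation V := 'rV[R]_n.
Implicit Types (x y z v w : V).

Lemma normv0 : N 0 = 0.
Proof. by rewrite -(scale0r (0 : V)) (is_norm_scale N_norm) normr0 mul0r. Qed.

Lemma normvN v : N (- v) = N v.
Proof. by rewrite -scaleN1r (is_norm_scale N_norm) normrN1 mul1r. Qed.

Lemma normv_ge0 v : 0 <= N v.
Proof.
have := is_norm_triangle N_norm v (- v).
by rewrite subrr normv0 normvN; lra.
Qed.

Lemma normv_gt0 v : v <> 0 -> 0 < N v.
Proof.
move=> v0; rewrite lt_neqAle normv_ge0 andbT eq_sym.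
by apply/eqP => /(is_norm_eq0 N_norm).
Qed.

Lemma distvC x y : N (x - y) = N (y - x).
Proof. by rewrite -normvN opprB. Qed.

Lemma normvZ_ge0 (a : R) v : 0 <= a -> N (a *: v) = a * N v.
Proof. by move=> a0; rewrite (is_norm_scale N_norm) ger0_norm. Qed.

Lemma distv_triangle y x z : N (x - z) <= N (x - y) + N (y - z).
Proof. by rewrite -[x - z](subrKA y) (is_norm_triangle N_norm). Qed.

Lemma normv_combination (t : R) x y :
  0 <= t -> t <= 1 -> N ((1 - t) *: x + t *: y) <= (1 - t) * N x + t * N y.
Proof.
move=> t0 t1; have := is_norm_triangle N_norm ((1 - t) *: x) (t *: y).
by rewrite !normvZ_ge0 ?subr_ge0.
Qed.

Lemma distv_combination (t : R) x y z : 0 <= t -> t <= 1 ->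
  N ((1 - t) *: x + t *: y - z) <= (1 - t) * N (x - z) + t * N (y - z).
Proof.
move=> t0 t1; rewrite (_ : _ - z = (1 - t) *: (x - z) + t *: (y - z)).
  exact: normv_combination.
by row_field.
Qed.

Lemma coord_le_norm v i : `|v ord0 i| <= `|v|.
Proof.
rewrite [leRHS]/Num.norm /= mx_normrE.
by apply: (le_bigmax _ (fun ij : 'I_1 * 'I_n => `|v ij.1 ij.2|) (ord0, i)).
Qed.

Lemma normv_upper_bound : exists2 K : R, 0 < K & forall v, N v <= K * `|v|.
Proof.
have sum_le (r : seq 'I_n) (F : 'I_n -> V) :
    N (\sum_(i <- r) F i) <= \sum_(i <- r) N (F i).
  elim: r => [|i r IHr]; first by rewrite !big_nil normv0.
  rewrite !big_cons; apply: le_trans (is_norm_triangle N_norm _ _) _.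
  by rewrite lerD2l.
exists (1 + \sum_(i < n) N (delta_mx ord0 i)) => [|v].
  by rewrite ltr_wpDr // sumr_ge0 // => i _; exact: normv_ge0.
rewrite {1}(row_sum_delta v); apply: le_trans (sum_le _ _) _.
rewrite mulrDl mul1r mulr_suml ler_wpDl // ler_sum // => i _.
by rewrite (is_norm_scale N_norm) mulrC ler_wpM2l ?normv_ge0 // coord_le_norm.
Qed.

Lemma lipschitz_continuous (g : V -> R) (K : R) :
  0 < K -> (forall x y, g x <= g y + K * `|x - y|) -> continuous g.
Proof.
move=> K0 gK x; apply/(@cvgrPdist_lt _ _ _ (nbhs x) (nbhs_filter x)) => e e0.
apply/nbhs_ballP; exists (e / K) => [|y]; first by rewrite /= divr_gt0.
rewrite -ball_normE /ball_ /= => xy.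
rewrite ltr_pdivlMr // mulrC in xy.
have := gK x y; have := gK y x; rewrite (distrC y x) => ? ?.
by rewrite ltr_norml; apply/andP; split; lra. Qed.

Lemma distv_continuous y : continuous (fun x => N (x - y)).
Proof.
have [K K0 NK] := normv_upper_bound.
apply: (lipschitz_continuous K0) => x z.
by apply: le_trans (distv_triangle z x y) _; rewrite addrC lerD2l.
Qed.

Lemma normv_lower_bound : exists2 k : R, 0 < k & forall v, k * `|v| <= N v.
Proof.
have [[v0 v0N]|all0] := pselect (exists v : V, v <> 0); last first.
  exists 1 => // v; have -> : v = 0 by apply: contrapT => v0; apply: all0; exists v.
  by rewrite normr0 mulr0 normv0.
pose S : set V := [set v | `|v| = 1].
have unitS v : v <> 0 -> S (`|v|^-1 *: v).
  move=> /eqP v1; rewrite /S /= normrZ normfV normr_id mulVf // normr_eq0.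
  exact: v1.
have Scompact : compact S.
  apply: bounded_closed_compact.
    by exists 1; split=> // r r1 v /= ->; exact: ltW.
  have -> : S = (fun v : V => `|v|) @^-1` [set 1] by [].
  by apply: preimage_closed => [v _|]; [exact: norm_continuous|exact: closed_eq].
have [u uS umin] : exists2 u, u \in S & forall v, v \in S -> N u <= N v.
  apply: EVT_min_rV => //; first by exists (`|v0|^-1 *: v0); exact: unitS.
  apply: continuous_subspaceT.
  rewrite (_ : N = fun x => N (x - 0)); first exact: distv_continuous.
  by apply/funext => v; rewrite subr0.
have Nu0 : 0 < N u.
  apply: normv_gt0 => u0; move: uS; rewrite u0 inE /S /= normr0.
  by move/eqP; rewrite eq_sym oner_eq0.
exists (N u) => // v; have [->|/eqP v1] := eqVneq v 0.
  by rewrite normr0 mulr0 normv0.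
have vp : 0 < `|v| by rewrite normr_gt0; apply/eqP.
have := umin _ (mem_set (unitS v v1)).
by rewrite (is_norm_scale N_norm) ger0_norm ?invr_ge0 // ler_pdivlMl // mulrC.
Qed.

Lemma closed_norm_bounded_compact (S : set V) :
  closed S -> norm_bounded N S -> compact S.
Proof.
move=> Scl [r Sr]; apply: bounded_closed_compact => //.
have [k k0 kN] := normv_lower_bound.
exists (r / k); split; first exact: num_real.
move=> M rM v /Sr Nv /=; apply: le_trans (ltW rM).
by rewrite ler_pdivlMr // mulrC (le_trans (kN v)).
Qed.

(** The segment in the definition may be cut down to its midpoint: if the
    midpoint of two points of the unit ball had norm at least 1, convexity of
    the norm would force norm 1 all along the segment, and a point of norm 1 is
    not interior to the ball because it can be pushed outwards radially. *)
Lemma strictly_convex_midpoint : strictly_convex N ->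
  forall a b, N a <= 1 -> N b <= 1 -> a <> b -> N (2^-1 *: (a + b)) < 1.
Proof.
move=> strict a b a1 b1 ab; rewrite ltNge; apply/negP => mid.
apply: strict; exists a, b; split=> // _ [t /= /[!in_itv] /= /andP[t0 t1] <-].
set p := _ + _.
have p1 : N p <= 1.
  by have := normv_combination a b t0 t1; rewrite -/p; nra.
(* The reflection of p in the midpoint is also in the ball, so p cannot have
   norm less than 1. *)
have p2 : N ((1 - (1 - t)) *: a + (1 - t) *: b) <= 1.
  have s0 : 0 <= 1 - t by lra.
  have s1 : 1 - t <= 1 by lra.
  by have := normv_combination a b s0 s1; nra.
have pE : N p = 1.
  have := is_norm_triangle N_norm (2^-1 *: p) 
    (2^-1 *: ((1 - (1 - t)) *: a + (1 - t) *: b)).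
  rewrite !normvZ_ge0 // -scalerDr (_ : p + _ = a + b); first lra.
  by rewrite /p; row_field.
split; first by apply: subset_closure; rewrite /closed_ball_ /= sub0r normvN.
move=> /= /nbhs_ballP [e /= e0 pe].
have p0 : p <> 0 by move=> p0; move: pE; rewrite p0 normv0; lra.
have np0 : 0 < `|p| by rewrite normr_gt0; apply/eqP.
pose d : R := e / 2 / `|p|.
have d0 : 0 < d by rewrite !divr_gt0.
have : `|p - (p + d *: p)| < e.
  rewrite opprD addrA subrr sub0r normrN normrZ gtr0_norm // divfK ?gt_eqF //.
  lra.
move=> pd; have := pe (p + d *: p); rewrite -ball_normE /= => /(_ pd).
rewrite /closed_ball_ /= sub0r normvN -[X in X + _]scale1r -scalerDl.
by rewrite normvZ_ge0 ?pE ?mulr1; lra.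
Qed.

(** * Diameters and completions *)

Section Diameter.
Implicit Types (C D K S : set V).

Lemma dist_le_diam S x y : norm_bounded N S -> S x -> S y -> N (x - y) <= diam N S.
Proof.
move=> [r Sr] Sx Sy; apply: ub_le_sup; last by exists x => //; exists y.
exists (r + r) => _ [a Sa [b Sb <-]].
have := is_norm_triangle N_norm a (- b); rewrite normvN.
by have := Sr a Sa; have := Sr b Sb; lra.
Qed.

Lemma diam_le S d : S !=set0 ->
  (forall x y, S x -> S y -> N (x - y) <= d) -> diam N S <= d.
Proof.
move=> [x Sx] Sd; apply: ge_sup; first by exists (N (x - x)), x => //; exists x.
by move=> _ [a Sa [b Sb <-]]; exact: Sd.
Qed.

Lemma norm_bounded_pairwise S d :
  (forall x y, S x -> S y -> N (x - y) <= d) -> norm_bounded N S.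
Proof.
move=> Sd; have [[x Sx]|S0] := pselect (S !=set0); last first.
  by exists 0 => x Sx; case: S0; exists x.
exists (d + N x) => y Sy.
have := is_norm_triangle N_norm (y - x) x; rewrite subrK => /le_trans; apply.
by rewrite lerD2r; exact: Sd.
Qed.

Lemma sub_norm_bounded S D : S `<=` D -> norm_bounded N D -> norm_bounded N S.
Proof. by move=> SD [r Dr]; exists r => x /SD /Dr. Qed.

Lemma complete_setP C : complete_set N C ->
  forall x, C x <-> forall y, C y -> N (x - y) <= diam N C.
Proof.
move=> [bC [c Cc] Cmax] x; split=> [Cx y Cy|xC]; first exact: dist_le_diam.
apply: contrapT => nCx; have := Cmax x nCx; rewrite ltNge => /negP; apply.
have d0 : 0 <= diam N C by apply: le_trans (xC c Cc); exact: normv_ge0.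
apply: diam_le => [|a b [Ca|->] [Cb|->]]; first by exists c; left.
- exact: dist_le_diam.
- by rewrite distvC; exact: xC.
- exact: xC.
- by rewrite subrr normv0.
Qed.

Lemma complete_set_sub_eq C D : complete_set N C -> complete_set N D ->
  diam N C = diam N D -> D `<=` C -> D = C.
Proof.
move=> Ccomp Dcomp CD DC; apply/seteqP; split=> // x Cx.
apply/(complete_setP Dcomp) => y /DC Cy.
by rewrite -CD; apply: dist_le_diam => //; case: Ccomp.
Qed.

(** Zorn's lemma for the sets whose union with S still has all distances at
    most d: a maximal one contains S, and no point can be added to it without
    enlarging the diameter. *)
Lemma pairwise_completion S d : S !=set0 ->
  (forall x y, S x -> S y -> N (x - y) <= d) ->
  exists D, [/\ S `<=` D, norm_bounded N D,
    (forall x y, D x -> D y -> N (x - y) <= d) &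
    forall x, (forall y, D y -> N (x - y) <= d) -> D x].
Proof.
move=> [s Ss] Sd.
have d0 : 0 <= d by apply: le_trans (Sd s s Ss Ss); exact: normv_ge0.
pose P (A : set V) := forall x y, (A `|` S) x -> (A `|` S) y -> N (x - y) <= d.
have [F FP Ftot|A [PA Amax]] := @Zorn_bigcup _ P.
  move=> x y [[A FA Ax]|Sx] [[B FB By]|Sy].
  - case: (Ftot _ _ FA FB) => AB.
      by apply: (FP _ FB); left=> //; exact: AB.
    by apply: (FP _ FA); left=> //; exact: AB.
  - by apply: (FP _ FA); [left|right].
  - by apply: (FP _ FB); [right|left].
  - exact: Sd.
have maxA B : A `<=` B -> P B -> B `<=` A.
  move=> AB PB x Bx; apply: contrapT => nAx; apply: (Amax B) => //.
  by split=> // BA; apply: nAx; exact: BA.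
have SA : S `<=` A.
  suff : A `|` S `<=` A by move=> AS x Sx; apply: AS; right.
  apply: maxA => [x|x y]; first by left.
  by rewrite -setUA setUid; exact: PA.
have Ad x y : A x -> A y -> N (x - y) <= d by move=> *; apply: PA; left.
exists A; split=> //; first exact: norm_bounded_pairwise Ad.
move=> x xA; suff : A `|` [set x] `<=` A by apply; right.
apply: maxA => [y|y z]; first by left.
have -> : A `|` [set x] `|` S = A `|` [set x].
  by apply/setUidPl => t St; left; exact: SA.
move=> [Ay|->] [Az|->]; [exact: Ad| |exact: xA|by rewrite subrr normv0].
by rewrite distvC; exact: xA.
Qed.

Lemma exists_completion S : S !=set0 -> norm_bounded N S ->
  exists D, completion N S D.
Proof.
move=> S0 bS; have [|D [SD bD Dd Dmax]] := pairwise_completion S0 (d := diam N S).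
  by move=> *; exact: dist_le_diam.
have D0 : D !=set0 by case: S0 => s /SD; exists s.
have DS : diam N D = diam N S.
  apply/eqP; rewrite eq_le diam_le //=; apply: diam_le => // x y /SD Dx /SD Dy.
  exact: dist_le_diam.
exists D; split=> //; split=> // x nDx; rewrite ltNge DS; apply/negP => Dx_le.
apply: nDx; apply: Dmax => y Dy; apply: le_trans Dx_le.
apply: dist_le_diam; [|by right|by left].
case: bD => r Dr; exists (Num.max r (N x)) => z [/Dr|->]; rewrite le_max.
  by move=> ->.
by rewrite lexx orbT.
Qed.

End Diameter.

(** * Unit balls touched from inside by a Euclidean ball *)

Section EuclideanTouching.

Definition dotv (u v : V) : R := \sum_i u ord0 i * v ord0 i.

Lemma dotvDl u v w : dotv (u + v) w = dotv u w + dotv v w.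
Proof. by rewrite /dotv -big_split; apply: eq_bigr => i _; rewrite mxE mulrDl. Qed.

Lemma dotvZl (a : R) u w : dotv (a *: u) w = a * dotv u w.
Proof. by rewrite /dotv mulr_sumr; apply: eq_bigr => i _; rewrite mxE mulrA. Qed.

Lemma dotvC u v : dotv u v = dotv v u.
Proof. by apply: eq_bigr => i _; rewrite mulrC. Qed.

Lemma dotv_ge0 u : 0 <= dotv u u.
Proof. by apply: sumr_ge0 => i _; rewrite -expr2 sqr_ge0. Qed.

Lemma dotv_square_expand u v (a : R) :
  dotv (u + a *: v) (u + a *: v) = dotv u u + 2 * a * dotv v u + a ^+ 2 * dotv v v.
Proof.
rewrite !(dotvDl, dotvZl) !(dotvC _ (u + _)) !(dotvDl, dotvZl) (dotvC u v).
ring.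
Qed.

Lemma sqr_norm_le_dotv v : `|v| ^+ 2 <= dotv v v.
Proof.
have [->|v0] := eqVneq v 0; first by rewrite normr0 expr0n dotv_ge0.
have [[i j] /= vE] : exists ij : 'I_1 * 'I_n, `|v| = `|v ij.1 ij.2|.
  by rewrite -normr_eq0 in v0; exact: mx_norm_neq0 v0.
rewrite vE (ord1 i) real_normK ?num_real // /dotv (bigD1 j) //= expr2 lerDl.
by apply: sumr_ge0 => k _; rewrite -expr2 sqr_ge0.
Qed.

Lemma dotv_le_sqr_norm v : dotv v v <= n%:R * `|v| ^+ 2.
Proof.
apply: (@le_trans _ _ (\sum_(i < n) `|v| ^+ 2)); last first.
  by rewrite sumr_const card_ord mulr_natl.
apply: ler_sum => i _; rewrite -expr2 -(real_normK (num_real (v ord0 i))).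
by rewrite lerXn2r ?nnegrE // coord_le_norm.
Qed.

Lemma norm_le_of_dotv_le u v : dotv u u <= dotv v v -> `|u| <= (n%:R + 1) * `|v|.
Proof.
move=> uv; rewrite -(@ler_pXn2r _ 2) ?nnegrE ?mulr_ge0 ?addr_ge0 //.
apply: le_trans (sqr_norm_le_dotv u) _; apply: le_trans uv _.
apply: le_trans (dotv_le_sqr_norm v) _; rewrite exprMn ler_wpM2r ?sqr_ge0 //.
by have := ler0n R n; nra.
Qed.

Lemma dotv_square_continuous w : continuous (fun x => dotv (x - w) (x - w)).
Proof.
apply: (@continuous_big R 'I_n +%R 0 xpredT (@add_continuous R) V (index_enum _)
  (fun i x => (x - w) ord0 i * (x - w) ord0 i)) => i _ x.
have cB : {for x, continuous (fun x : V => (x - w) ord0 i)}.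
  rewrite (_ : (fun _ => _) = fun x : V => x ord0 i - w ord0 i); last first.
    by apply/funext => z; rewrite !mxE.
  by apply: continuousB; [exact: coord_continuous|exact: cst_continuous].
exact: (continuousM cB cB).
Qed.

(** A Euclidean ball around w with x on its surface, contained in the unit ball
    around y with x on its surface too, forces the two surfaces to share their
    tangent hyperplane at x. Otherwise some v pointing outwards for the Euclidean
    ball would enter the N-ball, and after a small tilt v would point strictly
    outwards; then - v points into the Euclidean ball, and x would lie between
    two points of the N-ball, one of them interior. *)
Lemma touching_halfspace x w y v :
  dotv (x - w) (x - w) != 0 ->
  (forall z, dotv (z - w) (z - w) < dotv (x - w) (x - w) -> N (z - y) <= 1) ->
  N (x - y) = 1 -> 0 <= dotv v (x - w) -> 1 <= N (x - y + v).
Proof.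
set u := x - w; set a := x - y => u0 inball a1 vu; rewrite leNgt; apply/negP => av.
have {u0} uu : 0 < dotv u u by rewrite lt_neqAle eq_sym u0 dotv_ge0.
pose e := (1 - N (a + v)) / (1 + N u).
have Nu : 0 < 1 + N u by have := normv_ge0 u; lra.
have e0 : 0 < e by rewrite divr_gt0 // subr_gt0.
pose v' := v + e *: u.
have av' : N (a + v') < 1.
  rewrite /v' addrA; apply: le_lt_trans (is_norm_triangle N_norm _ _) _.
  rewrite (normvZ_ge0 _ (ltW e0)).
  have : e * (1 + N u) = 1 - N (a + v) by rewrite divfK ?gt_eqF.
  by nra.
have v'u : 0 < dotv v' u by rewrite dotvDl dotvZl; nra.
pose t := dotv v' u / (dotv v' v' + dotv v' u).
have q0 := dotv_ge0 v'.
have den : 0 < dotv v' v' + dotv v' u by lra.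
have t0 : 0 < t by rewrite divr_gt0.
have tE : t * (dotv v' v' + dotv v' u) = dotv v' u by rewrite divfK ?gt_eqF.
have : N (a - t *: v') <= 1.
  rewrite /a (_ : _ - _ = (x - t *: v') - y); last by row_field.
  apply: inball; rewrite (_ : _ - w = u + (- t) *: v'); last by rewrite /u; row_field.
  by rewrite dotv_square_expand; nra.
have := is_norm_triangle N_norm (t *: (a + v')) (a - t *: v').
rewrite (normvZ_ge0 _ (ltW t0)) (_ : _ + _ = (1 + t) *: a); last by row_field.
by rewrite normvZ_ge0 ?a1; nra.
Qed.

(** By strict convexity the midpoint of two distinct unit vectors x - y1 and
    x - y2 has norm less than 1. It is reached from x - y1 and from x - y2 by
    opposite displacements, one of which points into the common outer
    half-space of the touching Euclidean ball. *)
Lemma touching_center_unique x w y1 y2 : strictly_convex N ->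
  dotv (x - w) (x - w) != 0 ->
  (forall z, dotv (z - w) (z - w) < dotv (x - w) (x - w) ->
     N (z - y1) <= 1 /\ N (z - y2) <= 1) ->
  N (x - y1) = 1 -> N (x - y2) = 1 -> y1 = y2.
Proof.
move=> strict u0 inball xy1 xy2; apply: contrapT => y12.
have mid : N (2^-1 *: ((x - y1) + (x - y2))) < 1.
  apply: strictly_convex_midpoint; rewrite ?xy1 ?xy2 //.
  by move=> /addrI /oppr_inj.
have outer y y' : N (x - y) = 1 ->
    (forall z, dotv (z - w) (z - w) < dotv (x - w) (x - w) -> N (z - y) <= 1) ->
    N (2^-1 *: ((x - y) + (x - y'))) < 1 -> dotv (2^-1 *: (y - y')) (x - w) < 0.
  move=> xy yball; rewrite (_ : _ *: _ = x - y + 2^-1 *: (y - y')); last by row_field.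
  by apply: contraTT; rewrite -!leNgt; exact: touching_halfspace.
have := outer _ _ xy1 (fun z zw => (inball z zw).1) mid.
rewrite addrC in mid.
have := outer _ _ xy2 (fun z zw => (inball z zw).2) mid.
rewrite -(opprB y1) scalerN -scaleN1r dotvZl; lra.
Qed.

End EuclideanTouching.

(** * The largest distance from a point to a compact set *)

Section FarthestDistance.
Implicit Types (C K S : set V).

Lemma compact_norm_bounded S : compact S -> norm_bounded N S.
Proof.
move=> /compact_bounded [M [_ SM]]; have [K K0 NK] := normv_upper_bound.
exists (K * (M + 1)) => x Sx; apply: le_trans (NK x) _.
by rewrite ler_pM2l //; apply: SM Sx; rewrite ltrDl.
Qed.

Lemma farthest_point S x : compact S -> S !=set0 ->
  exists2 y, S y & forall z, S z -> N (x - z) <= N (x - y).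
Proof.
move=> cS S0.
have [y] : exists2 y, y \in S & forall z, z \in S -> N (z - x) <= N (y - x).
  by apply: EVT_max_rV => //; apply: continuous_subspaceT; exact: distv_continuous.
rewrite inE => Sy ymax; exists y => // z Sz.
by rewrite distvC (distvC x y); apply: ymax; rewrite inE.
Qed.

Definition reach S x : R := sup [set N (x - y) | y in S].

Lemma reach_le S x d : S !=set0 -> (forall y, S y -> N (x - y) <= d) -> reach S x <= d.
Proof.
move=> [s Ss] Sd; apply: ge_sup; first by exists (N (x - s)), s.
by move=> _ [y Sy <-]; exact: Sd.
Qed.

Variables (S : set V) (cS : compact S) (S0 : S !=set0).

Lemma le_reach x y : S y -> N (x - y) <= reach S x.
Proof.
move=> Sy; have [z _ zmax] := farthest_point x cS S0.
apply: ub_le_sup; last by exists y.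
by exists (N (x - z)) => _ [t St <-]; exact: zmax.
Qed.

Lemma reach_attained x : exists2 y, S y & N (x - y) = reach S x.
Proof.
have [y Sy ymax] := farthest_point x cS S0.
by exists y => //; apply/eqP; rewrite eq_le le_reach //= reach_le.
Qed.

Lemma reach_triangle x z : reach S x <= reach S z + N (x - z).
Proof.
apply: reach_le => // y Sy; apply: le_trans (distv_triangle z x y) _.
by rewrite addrC lerD2r le_reach.
Qed.

Lemma reach_combination (t : R) x z : 0 <= t -> t <= 1 ->
  reach S ((1 - t) *: x + t *: z) <= (1 - t) * reach S x + t * reach S z.
Proof.
move=> t0 t1; apply: reach_le => // y Sy.
apply: le_trans (distv_combination x z y t0 t1) _.
by apply: lerD; apply: ler_wpM2l; rewrite ?subr_ge0 ?le_reach.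
Qed.

Lemma reach_continuous : continuous (reach S).
Proof.
have [K K0 NK] := normv_upper_bound; apply: (lipschitz_continuous K0) => x z.
by apply: le_trans (reach_triangle x z) _; rewrite lerD2l.
Qed.

Lemma reach_crossing a b (r : R) : reach S a <= r -> r <= reach S b ->
  exists2 t : R, 0 <= t <= 1 & reach S ((1 - t) *: a + t *: b) = r.
Proof.
move=> ar rb.
have [||t] := @IVT R (fun t : R => reach S (a + t *: (b - a))) 0 1 r ler01.
- apply: continuous_subspaceT => t.
  apply: (@continuous_comp _ _ _ (fun t : R => a + t *: (b - a)) (reach S) t).
    apply: (@continuousD _ _ _ (fun=> a) (fun t : R => t *: (b - a))).
      exact: cst_continuous.
    exact: scalel_continuous.
  exact: reach_continuous.
- rewrite scale0r addr0 scale1r addrC subrK ge_min ar /=.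
  by rewrite le_max rb orbT.
rewrite in_itv /= => t01 <-; exists t => //.
by congr (reach S _); row_field.
Qed.

(** Take x' nearest to w, in the Euclidean norm, among the points at reach at
    least 1. The Euclidean ball around w through x' lies in the unit ball around
    every point of S, so it touches the unit sphere around any point of S
    farthest from x', which by touching_center_unique leaves only one such point.
    The Euclidean norm serves here because its balls are smooth, which the
    balls of N need not be. *)
Lemma unique_farthest_near w x : strictly_convex N -> reach S w < 1 -> 1 <= reach S x ->
  exists x' y, [/\ `|x' - w| <= (n%:R + 1) * `|x - w|, reach S x' = 1, S y &
    forall z, S z -> N (x' - z) = 1 <-> z = y].
Proof.
move=> strict w1 x1.
pose q z := dotv (z - w) (z - w).
pose A : set V := [set z | 1 <= reach S z] `&` [set z | q z <= q x].
have cA : compact A.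
  apply: closed_norm_bounded_compact.
    apply: closedI.
      apply: (@preimage_closed _ _ (reach S) [set r | 1 <= r]); last exact: closed_ge.
      by move=> z _; exact: reach_continuous.
    apply: (@preimage_closed _ _ q [set r | r <= q x]); last exact: closed_le.
    by move=> z _; exact: dotv_square_continuous.
  have [K K0 NK] := normv_upper_bound.
  exists (N w + K * ((n%:R + 1) * `|x - w|)) => z [_ /= zq].
  have := is_norm_triangle N_norm w (z - w); rewrite addrC subrK => /le_trans; apply.
  rewrite lerD2l; apply: le_trans (NK _) _.
  by rewrite ler_pM2l //; exact: norm_le_of_dotv_le.
have [x'] : exists2 x', x' \in A & forall z, z \in A -> q x' <= q z.
  apply: EVT_min_rV => //; first by exists x; split => /=.
  by apply: continuous_subspaceT; exact: dotv_square_continuous.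
rewrite inE => -[/= x'1 x'q] x'min.
have inside z : q z < q x' -> reach S z < 1.
  move=> zx'; rewrite ltNge; apply/negP => z1.
  move: (zx'); rewrite ltNge => /negP; apply; apply: x'min; rewrite inE.
  by split=> //=; rewrite ltW // (lt_le_trans zx').
have x'w : q x' != 0.
  apply/negP => /eqP q0; move: x'1; rewrite leNgt => /negP; apply.
  suff -> : x' = w by [].
  apply/eqP; rewrite -subr_eq0 -normr_eq0; apply/eqP.
  have := sqr_norm_le_dotv (x' - w); rewrite -/(q x') q0.
  by have := normr_ge0 (x' - w); nra.
have reach1 : reach S x' = 1.
  apply/eqP; rewrite eq_le x'1 andbT; apply/ler_addgt0Pr => e e0.
  pose t := Num.min 1 (e / (1 + N (x' - w))).
  have Np : 0 < 1 + N (x' - w) by have := normv_ge0 (x' - w); lra.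
  have t0 : 0 < t by rewrite lt_min ltr01 divr_gt0.
  have t1 : t <= 1 by rewrite ge_min lexx.
  have te : t * N (x' - w) <= e.
    have : t * (1 + N (x' - w)) <= e.
      by rewrite -ler_pdivlMr // ge_min lexx orbT.
    by have := normv_ge0 (x' - w); nra.
  have := reach_triangle x' (x' + (- t) *: (x' - w)).
  rewrite (_ : x' - (x' + _) = t *: (x' - w)); last by row_field.
  rewrite normvZ_ge0; last exact: ltW.
  have : reach S (x' + (- t) *: (x' - w)) < 1.
    apply: inside; rewrite /q (_ : _ - w = (1 - t) *: (x' - w)); last by row_field.
    rewrite dotvZl dotvC dotvZl mulrA -/(q x').
    have : 0 < q x' by rewrite lt_neqAle eq_sym x'w dotv_ge0.
    by move: (q x') => Q Q0; have := mulr_gt0 t0 Q0; nra.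
  lra.
have [y Sy yx'] := reach_attained x'.
exists x', y; split=> //; first exact: norm_le_of_dotv_le.
move=> z Sz; split=> [zx'|->]; last by rewrite yx'.
apply: (@touching_center_unique x' w) => //; last by rewrite yx'.
by move=> v /inside v1; split; (apply: le_trans (ltW v1); exact: le_reach).
Qed.

End FarthestDistance.

(** * Complete sets of diameter 1 and their b-exposed points *)

Section UnitCompleteSet.
Local Open Scope convex_scope.
Variables (N_strict : strictly_convex N) (C : set V).
Variables (C_complete : complete_set N C) (C_diam : diam N C = 1).
Implicit Types (K D : set V).

Lemma unit_completeP x : C x <-> forall y, C y -> N (x - y) <= 1.
Proof. by rewrite -C_diam; exact: complete_setP. Qed.

Lemma unit_complete_nonempty : C !=set0.
Proof. by case: C_complete. Qed.

Lemma unit_complete_closed : closed C.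
Proof.
rewrite (_ : C = \bigcap_(y in C) [set x | N (x - y) <= 1]); last first.
  by apply/seteqP; split=> x /unit_completeP.
apply: closed_bigI => y _.
apply: (@preimage_closed _ _ (fun x => N (x - y)) [set r | r <= 1]); last exact: closed_le.
by move=> x _; exact: distv_continuous.
Qed.

Lemma unit_complete_compact : compact C.
Proof.
apply: closed_norm_bounded_compact; first exact: unit_complete_closed.
by case: C_complete.
Qed.

Lemma unit_complete_convex : convex_set (C : set (convex_lmodType V)).
Proof.
move=> x y l /[!inE] Cx Cy; apply/unit_completeP => z Cz.
have -> : x <| l |> y = (1 - (1 - l%:num)) *: x + (1 - l%:num) *: y.
  by rewrite subKr.
have l0 : 0 <= l%:num by [].
have l1 : l%:num <= 1 by [].
have s0 : 0 <= 1 - l%:num by lra.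
have s1 : 1 - l%:num <= 1 by lra.
apply: le_trans (distv_combination x y z s0 s1) _.
have := unit_completeP x; move=> [/(_ Cx) /(_ z Cz) ? _].
have := unit_completeP y; move=> [/(_ Cy) /(_ z Cz) ? _].
by nra.
Qed.

Lemma b_expP y : b_exp N C y <-> exists x, [/\ C x, C y, N (x - y) = 1 &
  forall z, C z -> N (x - z) = 1 -> z = y].
Proof.
split=> [[x [[xball _] yE]]|[x [Cx Cy xy xuniq]]].
  have [Cy xy] : (C `&` sphere N x 1) y by rewrite -yE.
  exists x; split=> // [|z Cz xz]; first by apply/unit_completeP => z /xball.
  suff : (C `&` sphere N x 1) z by rewrite -yE.
  by [].
exists x; split; first split.
- by move=> z; move/unit_completeP: Cx => /[apply].
- by exists y.
- by apply/seteqP; split=> [z ->|z [Cz xz]] //; exact: xuniq.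
Qed.

Lemma b_exp_sub : b_exp N C `<=` C.
Proof. by move=> y /b_expP [x []]. Qed.

Lemma unit_complete_distinct : exists a b, [/\ C a, C b & a <> b].
Proof.
apply: contrapT => Csub; have : diam N C <= 0; last by rewrite C_diam; lra.
apply: diam_le; first exact: unit_complete_nonempty.
move=> a b Ca Cb; suff -> : a = b by rewrite subrr normv0.
by apply: contrapT => ab; apply: Csub; exists a, b.
Qed.

(** Strict convexity puts the midpoint of two distinct points of C at distance
    less than 1 from every point of C. *)
Lemma deep_point : exists c, reach C c < 1.
Proof.
have [a [b [Ca Cb ab]]] := unit_complete_distinct.
exists (2^-1 *: (a + b)).
have [y Cy <-] := reach_attained unit_complete_compact unit_complete_nonempty
  (2^-1 *: (a + b)).
rewrite (_ : _ - y = 2^-1 *: ((a - y) + (b - y))); last by row_field.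
apply: strictly_convex_midpoint => //.
- by move/unit_completeP: Ca; exact.
- by move/unit_completeP: Cb; exact.
- by move=> /addIr.
Qed.

(** If z were outside C, the segment from a deep point c to z would leave C at a
    point x that is at distance at most 1 - e from every b-exposed point, for
    some e > 0, since x is an average of c and z with positive weight on c.
    Choose w near x where the largest distance to C is less than 1; near w there
    is a point with a unique farthest point in C, at distance 1. That farthest
    point is b-exposed and too far from x. *)
Lemma unit_ball_hull_b_exp z : (forall y, b_exp N C y -> N (z - y) <= 1) -> C z.
Proof.
move=> zball; apply: contrapT => nCz.
have cC := unit_complete_compact; have C0 := unit_complete_nonempty.
have [c c1] := deep_point.
have z1 : 1 < reach C z.
  rewrite ltNge; apply/negP => z1; apply: nCz; apply/unit_completeP => y Cy.
  exact: le_trans (le_reach cC C0 z Cy) z1.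
have [t /andP[t0 t1] xreach] := reach_crossing cC C0 (ltW c1) (ltW z1).
set x := _ + _ in xreach.
have t_lt1 : t < 1.
  rewrite lt_neqAle t1 andbT; apply/eqP => tE; move: xreach.
  by rewrite /x tE subrr scale0r add0r scale1r => z1E; move: z1; rewrite z1E ltxx.
pose e := (1 - t) * (1 - reach C c).
have e0 : 0 < e by rewrite mulr_gt0 ?subr_gt0.
have xball y : b_exp N C y -> N (x - y) <= 1 - e.
  move=> y_exp; apply: le_trans (distv_combination c z y t0 t1) _.
  have := zball _ y_exp; have := le_reach cC C0 c (b_exp_sub y_exp).
  by rewrite /e; nra.
have [K K0 NK] := normv_upper_bound.
(* A point x' within (n + 1) * |x - w| of w, where w - x = s * (c - x), satisfies
   N (x' - x) <= K * (n + 2) * s * |c - x|; s makes this less than e. *)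
pose M := K * (n%:R + 2) * `|c - x|.
have M0 : 0 <= M by rewrite !mulr_ge0 ?addr_ge0 // ltW.
pose s := Num.min 1 (e / (M + 1)).
have M1 : 0 < M + 1 by lra.
have s0 : 0 < s by rewrite lt_min ltr01 divr_gt0.
have s1 : s <= 1 by rewrite ge_min lexx.
have sM : s * M < e.
  have : s * (M + 1) <= e by rewrite -ler_pdivlMr // ge_min lexx orbT.
  by nra.
pose w := (1 - s) *: x + s *: c.
have w1 : reach C w < 1.
  apply: le_lt_trans (reach_combination cC C0 x c (ltW s0) s1) _.
  by rewrite xreach; nra.
have x1 : 1 <= reach C x by rewrite xreach.
have [x' [y [x'w x'1 Cy x'y]]] := unique_farthest_near cC C0 N_strict w1 x1.
have Cx' : C x'.
  by apply/unit_completeP => v Cv; rewrite -x'1; exact: le_reach.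
have y_exp : b_exp N C y.
  by apply/b_expP; exists x'; split=> // [|v Cv /x'y]; [apply/x'y|exact].
have : N (x' - y) = 1 by apply/x'y.
have xw : `|x - w| = s * `|c - x|.
  by rewrite (_ : x - w = (- s) *: (c - x)) ?normrZ ?normrN ?gtr0_norm // /w; row_field.
have x'x : N (x' - x) <= s * M.
  apply: le_trans (NK _) _.
  rewrite (_ : s * M = K * ((n%:R + 2) * `|x - w|)); last by rewrite xw /M; ring.
  rewrite ler_pM2l // -(subrKA w); apply: le_trans (ler_normD _ _) _.
  by rewrite (distrC w x); lra.
have := distv_triangle x x' y; have := xball _ y_exp.
lra.
Qed.

(** A b-exposed point y missing from K leaves K inside a ball smaller than the
    unit ball around the centre x of a sphere exposing y. Moving x slightly away
    from y then keeps it within 1 of K, and a completion of K with the moved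
    centre has diameter 1 but cannot be C, because the moved centre is too far
    from y. *)
Lemma b_exp_sub_unique_completion K : compact K -> unique (completion N K) C ->
  b_exp N C `<=` K.
Proof.
move=> cK [[bK K0 _ KC CK] Kuniq] y /b_expP [x [Cx Cy xy xuniq]].
apply: contrapT => nKy.
have [k Kk kmax] := farthest_point x cK K0.
have k1 : N (x - k) < 1.
  rewrite lt_neqAle; apply/andP; split.
    by apply/eqP => /(xuniq _ (KC _ Kk)) ky; apply: nKy; rewrite -ky.
  by move/unit_completeP: Cx; apply; exact: KC.
set r := N (x - k) in kmax k1.
have r0 : 0 <= r by exact: normv_ge0.
pose x' := x + (1 - r) *: (x - y).
have x'y : N (x' - y) = 2 - r.
  rewrite (_ : x' - y = (2 - r) *: (x - y)); last by rewrite /x'; row_field.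
  by rewrite normvZ_ge0 ?xy ?mulr1 //; lra.
have x'K z : K z -> N (x' - z) <= 1.
  move=> Kz; apply: le_trans (distv_triangle x _ _) _.
  rewrite (_ : x' - x = (1 - r) *: (x - y)); last by rewrite /x'; row_field.
  by rewrite normvZ_ge0 ?xy; have := kmax _ Kz; lra.
pose S := K `|` [set x'].
have S0 : S !=set0 by exists k; left.
have S1 a b : S a -> S b -> N (a - b) <= 1.
  move=> [Ka|->] [Kb|->]; last by rewrite subrr normv0.
  - by rewrite -C_diam CK; exact: dist_le_diam.
  - by rewrite distvC; exact: x'K.
  - exact: x'K.
have bS := norm_bounded_pairwise S1.
have [D [_ _ D_complete SD DS]] := exists_completion S0 bS.
have Sdiam : diam N S = diam N K.
  apply/eqP; rewrite eq_le -{1}CK C_diam diam_le //=.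
  by apply: diam_le => // a b Ka Kb; apply: dist_le_diam => //; left.
have CD : C = D.
  apply: Kuniq; split=> //; first by move=> a Ka; apply: SD; left.
  by rewrite DS.
have Cx' : C x' by rewrite CD; apply: SD; right.
have := proj1 (unit_completeP x') Cx' y Cy; rewrite x'y; lra.
Qed.

(** Otherwise every unit ball would vacuously contain the b-exposed points,
    hence C, and so every point of the space would belong to C. *)
Lemma b_exp_nonempty : b_exp N C !=set0.
Proof.
apply: contrapT => b0.
have allC z : C z by apply: unit_ball_hull_b_exp => y y_exp; case: b0; exists y.
have [a [b [_ _ ab]]] := unit_complete_distinct.
have ab0 : 0 < N (a - b) by apply: normv_gt0 => /subr0_eq.
have d0 : 0 <= 2 / N (a - b) by rewrite divr_ge0 // ltW.
have := proj1 (unit_completeP ((2 / N (a - b)) *: (a - b))) (allC _) 0 (allC _).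
by rewrite subr0 normvZ_ge0 // divfK ?gt_eqF //; lra.
Qed.

(** If K had diameter d < 1, a b-exposed point y could be moved by 1 - d in any
    direction and stay in C, in particular away from the centre of a sphere
    exposing it, which is at distance 1 already. *)
Lemma diam_b_exp_sub K : b_exp N C `<=` K -> K `<=` C -> diam N K = 1.
Proof.
move=> bK KC.
have bndC : norm_bounded N C by case: C_complete.
have bndK := sub_norm_bounded KC bndC.
have [y y_exp] := b_exp_nonempty.
have Ky := bK _ y_exp.
apply/eqP; rewrite eq_le; apply/andP; split.
  rewrite -C_diam; apply: diam_le => [|a b /KC Ca /KC Cb]; first by exists y.
  exact: dist_le_diam.
rewrite leNgt; apply/negP => d1.
have [x [Cx Cy xy _]] := (b_expP y).1 y_exp.
pose y' := y + (1 - diam N K) *: (y - x).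
have d0 : 0 <= 1 - diam N K by lra.
have : C y'.
  apply: unit_ball_hull_b_exp => b bb; apply: le_trans (distv_triangle y _ _) _.
  rewrite (_ : y' - y = (1 - diam N K) *: (y - x)); last by rewrite /y'; row_field.
  rewrite normvZ_ge0 // distvC xy.
  by have := dist_le_diam bndK Ky (bK _ bb); lra.
move=> /unit_completeP /(_ x Cx).
rewrite (_ : y' - x = (2 - diam N K) *: (y - x)); last by rewrite /y'; row_field.
by rewrite normvZ_ge0; rewrite ?(distvC y) ?xy; lra.
Qed.

End UnitCompleteSet.

End NormOnRows.

(** * Closed convex hulls *)

Section ConvexClosure.
Context {R : realType} {n : nat}.
Local Notation V := 'rV[R]_n.
Implicit Types A B : set V.

Lemma convex_closure A : @convex_set R V A -> @convex_set R V (closure A).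
Proof.
move=> cA x y l; rewrite !inE => Ax Ay B /nbhs_ballP [e /= e0 eB].
have [a [Aa xa]] := Ax _ (nbhsx_ballx x e e0).
have [b [Ab yb]] := Ay _ (nbhsx_ballx y e e0).
exists (@conv R (convex_lmodType V) l a b); split.
  by have := cA a b l; rewrite !inE; exact.
apply: eB; move: xa yb; rewrite -!ball_normE /ball_ /= => xa yb.
have l0 : 0 <= l%:num by [].
have l1 : 0 <= 1 - l%:num by rewrite subr_ge0.
have -> : @conv R (convex_lmodType V) l x y - @conv R (convex_lmodType V) l a b
    = l%:num *: (x - a) + (1 - l%:num) *: (y - b).
  change ((l%:num *: x + (1 - l%:num) *: y) - (l%:num *: a + (1 - l%:num) *: b) =
    l%:num *: (x - a) + (1 - l%:num) *: (y - b)).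
  by row_field.
apply: le_lt_trans (ler_normD _ _) _; rewrite !normrZ !ger0_norm //.
have m_lt : Num.max `|x - a| `|y - b| < e by rewrite gt_max xa yb.
apply: le_lt_trans m_lt; set m := Num.max _ _.
have xm : `|x - a| <= m by rewrite le_max lexx.
have ym : `|y - b| <= m by rewrite le_max lexx orbT.
by nra.
Qed.

Lemma convex_conv_hull A : @convex_set R V (conv_hull A).
Proof.
move=> x y l /[!inE] Ax Ay B [cB AB].
by have := cB x y l; rewrite !inE; apply; [exact: Ax|exact: Ay].
Qed.

Lemma closure_conv_hull_sub A B :
  closed B -> @convex_set R V B -> A `<=` B -> closure (conv_hull A) `<=` B.
Proof.
move=> clB cB AB; rewrite closureE; apply: smallest_sub => //.
exact: smallest_sub.
Qed.

End ConvexClosure.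

(** * The least body with a given unique completion *)

Theorem corollary7 (R : realType) (n : nat) (n_gt0 : (0 < n)%N)
    (N : 'rV[R]_n -> R) (N_norm : is_norm N) (N_strict : strictly_convex N)
    (C : set 'rV[R]_n) (C_complete : complete_set N C) (C_diam : diam N C = 1) :
  let K0 := closure (conv_hull (b_exp N C)) in
  unique (minimal (fun K => convex_body K /\ unique (completion N K) C)) K0.
Proof.
move=> K0.
have bK0 : b_exp N C `<=` K0.
  by apply: subset_trans (@subset_closure _ _); exact: sub_gen_smallest.
have K0C : K0 `<=` C.
  apply: closure_conv_hull_sub.
  - exact (unit_complete_closed N_norm C_complete C_diam).
  - exact (unit_complete_convex N_norm C_complete C_diam).
  - exact (b_exp_sub N_norm C_complete C_diam).
have K0diam : diam N K0 = 1.
  exact (diam_b_exp_sub N_norm N_strict C_complete C_diam bK0 K0C).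
have cK0 : compact K0.
  apply: subclosed_compact K0C; first exact: closed_closure.
  exact (unit_complete_compact N_norm C_complete C_diam).
have K0n : K0 !=set0.
  have [y /bK0 K0y] := b_exp_nonempty N_norm N_strict C_complete C_diam.
  by exists y.
have K0completion : unique (completion N K0) C.
  split=> [|D [bK _ D_complete K0D DK]].
    split=> //; last by rewrite K0diam.
    exact: compact_norm_bounded.
  have DC : D `<=` C.
    move=> z Dz; apply: (unit_ball_hull_b_exp N_norm N_strict C_complete C_diam).
    move=> y /bK0 /K0D Dy; rewrite -K0diam -DK.
    by apply: (dist_le_diam N_norm) => //; case: D_complete.
  by apply/esym/(complete_set_sub_eq N_norm C_complete) => //; rewrite DK K0diam.
have K0_least L : convex_body L -> unique (completion N L) C -> K0 `<=` L.
  move=> [cL convL _] Lcompl; apply: closure_conv_hull_sub => //.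
    exact: compact_closed (@norm_hausdorff _ _) cL.
  exact: b_exp_sub_unique_completion Lcompl.
have K0P : convex_body K0 /\ unique (completion N K0) C.
  split=> //; split=> //; apply: convex_closure; exact: convex_conv_hull.
split=> [|K [[Kbody Kcompl] Kmin]].
  split=> // L [Lbody Lcompl] LK0; apply/seteqP; split=> //.
  exact: K0_least.
by apply: Kmin => //; exact: K0_least.
Qed.
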